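(* Let $\mathcal{I}$ be a meager ideal on $\mathbf{N}$ and let $A=(a_{n,i})$ be a regular matrix such that $\lim_n\sum_i|a_{n,i}|=1$. Then the set $$\{x\in(0,1]: \Gamma_b^k(x,\mathcal{I},A)=\Delta_b^k \text{ for all integers } b\ge2,\ k\ge1\}$$ is comeager in $(0,1]$.
   Context: For an integer $b\ge 2$ and $x\in(0,1]$, write $x=\sum_{n\ge 1} d_{b,n}(x)/b^n$ for the unique nonterminating $b$-adic expansion, with digits $d_{b,n}(x)\in\{0,\dots,b-1\}$. Let $S_b^k$ be the set of strings $\bm{s}=s_1\cdots s_k$ of length $k$ over $\{0,\dots,b-1\}$. For $\bm{s}\in S_b^k$ and $n\ge1$ put $\pi_{b,\bm{s},n}(x)=\frac{1}{n}\#\{i\in\{1,\dots,n\}: d_{b,i+j-1}(x)=s_j \text{ for all } j=1,\dots,k\}$, and $\bm{\pi}^k_{b,n}(x)=(\pi_{b,\bm{s},n}(x):\bm{s}\in S_b^k)\in\mathbf{R}^{b^k}$. Let $\Delta_b^k=\{(p_{\bm{s}})_{\bm{s}\in S_b^k}\in\mathbf{R}^{b^k}: \sum_{\bm{s}}p_{\bm{s}}=1,\ p_{\bm{s}}\ge0,\ \sum_{s_0}p_{s_0\bm{s}}=\sum_{s_k}p_{\bm{s}s_k} \text{ for all } \bm{s}\in S_b^{k-1}\}$ (concatenated strings). An ideal on $\mathbf{N}$ is a family $\mathcal{I}\subseteq\mathcal{P}(\mathbf{N})$ closed under finite unions and subsets, containing all finite sets, and $\ne\mathcal{P}(\mathbf{N})$;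 it is meager if it is a meager subset of $\mathcal{P}(\mathbf{N})$ with the Cantor-space topology. A regular matrix is an infinite real matrix $A=(a_{n,i})_{n,i\in\mathbf{N}}$ such that for every $d$ and every $\mathbf{R}^d$-valued sequence $\bm{z}=(\bm{z}_i)$ converging to $\bm{\eta}$, the series $A_n\bm{z}:=\sum_i a_{n,i}\bm{z}_i$ exists for all $n$ and $\lim_n A_n\bm{z}=\bm{\eta}$. For a sequence $(x_n)$ in $\mathbf{R}^d$, $\eta$ is an $\mathcal{I}$-cluster point if $\{n: x_n\in U\}\notin\mathcal{I}$ for every open neighborhood $U$ of $\eta$. With $\bm{\pi}^k_b(x)=(\bm{\pi}^k_{b,n}(x):n\ge1)$, $\Gamma_b^k(x,\mathcal{I},A)$ denotes the set of $\mathcal{I}$-cluster points of $(A_n\bm{\pi}^k_b(x):n\ge1)$. *)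

(* Defs.v *)
From HB Require Import structures.
From mathcomp Require Import all_boot all_order all_algebra.
From mathcomp Require Import all_classical all_reals all_analysis.
From Stdlib Require Import ClassicalEpsilon.
Unset Printing Implicit Defensive.
Import Order.TTheory GRing.Theory Num.Theory.
Import numFieldNormedType.Exports.
Local Open Scope classical_set_scope.
Local Open Scope ring_scope.

Definition nowhere_dense_set {T : topologicalType} (A : set T) : Prop :=
  interior (closure A) = set0.

Definition meager_set {T : topologicalType} (A : set T) : Prop :=
  exists F : nat -> set T,
    (forall n, nowhere_dense_set (F n)) /\ A `<=` \bigcup_n F n.

Definition ideal_on_nat (I : set (set nat)) : Prop :=
  [/\ (forall X Y, I X -> I Y -> I (X `|` Y)),
      (forall X Y, Y `<=` X -> I X -> I Y),
      (forall X, finite_set X -> I X) &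
      I <> [set: set nat]].

(** P(N) carries the Cantor-space topology via X |-> indicator of X. *)
Definition meager_ideal (I : set (set nat)) : Prop :=
  meager_set [set f : cantor_space | I [set n | f n = true]].

(** Nonterminating b-adic expansion of x: digits d 1, d 2, ... (d 0 = 0 is
    a normalisation of the unused index). *)
Definition nonterm_expansion {R : realType} (b : nat) (x : R) (d : nat -> nat)
  : Prop :=
  [/\ d 0%N = 0%N,
      (forall n, (d n < b)%N),
      (fun N : nat => \sum_(1 <= n < N.+1) (d n)%:R / (b%:R ^+ n) : R)
         @ \oo --> x &
      (forall N : nat, exists n : nat, (N < n)%N /\ d n <> 0%N)].

Definition digit {R : realType} (b : nat) (x : R) : nat -> nat :=
  epsilon (inhabits (fun _ : nat => 0%N)) (nonterm_expansion b x).

Definition str (b k : nat) : finType := {ffun 'I_k -> 'I_b}.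

(** pi_{b,s,n}(x) = (1/n) #{ i in {1..n} : d_{i+j-1}(x) = s_j, j = 1..k }.
    (Rocq index i : 'I_n stands for i+1, and j : 'I_k for j+1.) *)
Definition freq {R : realType} (b k : nat) (x : R) (n : nat) (s : str b k) : R :=
  (#|[pred i : 'I_n | [forall j : 'I_k, digit b x (i.+1 + j)%N == nat_of_ord (s j)]]|)%:R
    / n%:R.

Definition vec (R : realType) (S : finType) := prod_topology (fun _ : S => R).

(** The sequence (pi^k_{b,n}(x) : n >= 1); the Rocq index m stands for n = m+1. *)
Definition pi_seq {R : realType} (b k : nat) (x : R) : nat -> vec R (str b k) :=
  fun m s => freq b k x m.+1 s.

Definition Aapp {R : realType} {S : finType} (A : nat -> nat -> R)
  (z : nat -> vec R S) (n : nat) : vec R S :=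
  fun s => lim (series (fun i => A n i * z i s) @ \oo).

Definition regular_matrix {R : realType} (A : nat -> nat -> R) : Prop :=
  forall (d : nat) (z : nat -> vec R 'I_d) (eta : vec R 'I_d),
    z @ \oo --> eta ->
    (forall n (j : 'I_d), cvg (series (fun i => A n i * z i j) @ \oo)) /\
    Aapp A z n @[n --> \oo] --> eta.

Definition I_cluster_point {T : topologicalType} (I : set (set nat))
  (u : nat -> T) (eta : T) : Prop :=
  forall U : set T, open U -> U eta -> ~ I [set n | U (u n)].

Definition Gamma {R : realType} (b k : nat) (x : R) (I : set (set nat))
  (A : nat -> nat -> R) : set (vec R (str b k)) :=
  [set eta | I_cluster_point I (Aapp A (pi_seq b k x)) eta].

Definition str_at {b m : nat} (t : {ffun 'I_m -> 'I_b}) (i : nat) (a : 'I_b)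
  : 'I_b :=
  match insub i with Some i' => t i' | None => a end.

Definition str_cons {b k : nat} (a : 'I_b) (t : str b k.-1) : str b k :=
  [ffun j : 'I_k => if nat_of_ord j == 0%N then a else str_at t j.-1 a].

Definition str_snoc {b k : nat} (t : str b k.-1) (a : 'I_b) : str b k :=
  [ffun j : 'I_k => if nat_of_ord j == k.-1 then a else str_at t j a].

Definition Delta {R : realType} (b k : nat) : set (vec R (str b k)) :=
  [set p | [/\ \sum_(s : str b k) p s = 1,
              (forall s, 0 <= p s) &
              (forall t : str b k.-1,
                 \sum_(a : 'I_b) p (str_cons a t) = \sum_(a : 'I_b) p (str_snoc t a))]].

(* Main.v *)
(* Let p be a point of Delta_b^k with positive coordinates, viewed as a
   circulation on the de Bruijn graph (strings of length k are edges, their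
   first and last k-1 letters are the endpoints). A walk that at each vertex
   takes an edge e underused relative to the transition probability
   p(e) / P(source e) has edge frequencies tending to p: if N_v counts the
   visits to v and f_v = N_v / P_v, the Dirichlet energy
   sum_e p(e) (f_source - f_target)^2 after n steps is O(n), so that
   all f_v agree up to o(n). Reading digits along such a walk after an
   arbitrary prefix gives, in every interval, a point whose frequency vectors
   converge to p; by regularity so do their A-transforms. On a finite window of
   rows these transforms depend on finitely many digits only, up to a small
   error, so they remain near p on a whole b-adic subinterval. By Talagrand's
   characterization of meager ideals it suffices to be near p on infinitely many
   windows [m_j, m_(j+1)), and this is a countable intersection of sets
   with dense interior; rational boxes meeting Delta_b^k make the family of
   conditions countable. The inclusion of the cluster set in Delta_b^k holds for
   every x: linear relations pass to the transforms, and nonnegativity does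
   because the hypothesis sum_i |a_(n,i)| -> 1 makes the negative parts of
   the rows vanish asymptotically. *)

Require Import Defs.
From HB Require Import structures.
From mathcomp Require Import all_boot all_order all_algebra.
From mathcomp Require Import all_classical all_reals all_analysis.
From mathcomp Require Import ring lra zify.
From Stdlib Require ClassicalEpsilon.
Import Order.TTheory GRing.Theory Num.Theory.
Import numFieldNormedType.Exports.
Local Open Scope classical_set_scope.
Local Open Scope ring_scope.

(** * Balanced walks on finite graphs *)

(** This is [u n = o(n)]. The constant absorbs the early terms, so that such bounds hold for every
    [n] and add up without thresholds. *)
Definition sublinear {R : realType} (u : nat -> R) : Prop :=
  forall e : R, 0 < e -> exists C : R, forall n, `|u n| <= e * n%:R + C.

Lemma sublinear_le {R : realType} (u v : nat -> R) :
  (forall n, `|u n| <= `|v n|) -> sublinear v -> sublinear u.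
Proof.
move=> uv hv e e0; have [C hC] := hv e e0; exists C => n.
exact: le_trans (uv n) (hC n).
Qed.

Lemma sublinear_bounded {R : realType} (u : nat -> R) (C : R) :
  (forall n, `|u n| <= C) -> sublinear u.
Proof.
move=> uC e e0; exists C => n; apply: (le_trans (uC n)).
by rewrite lerDr mulr_ge0// ltW.
Qed.

Lemma sublinearD {R : realType} (u v : nat -> R) :
  sublinear u -> sublinear v -> sublinear (fun n => u n + v n).
Proof.
move=> hu hv e e0; have e2 : 0 < e / 2 by rewrite divr_gt0.
have [C hC] := hu _ e2; have [C' hC'] := hv _ e2; exists (C + C') => n.
have := ler_normD (u n) (v n); have := hC n; have := hC' n; lra.
Qed.

Lemma sublinearZ {R : realType} (a : R) (u : nat -> R) :
  sublinear u -> sublinear (fun n => a * u n).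
Proof.
move=> hu e e0; have a0 : 0 < `|a| + 1 by rewrite ltr_wpDl.
have [C hC] := hu (e / (`|a| + 1)) (divr_gt0 e0 a0).
exists ((`|a| + 1) * C) => n; rewrite normrM.
apply: (@le_trans _ _ ((`|a| + 1) * `|u n|)).
  by rewrite ler_wpM2r// lerDl.
have -> : e * n%:R + (`|a| + 1) * C =
    (`|a| + 1) * (e / (`|a| + 1) * n%:R + C) by field; rewrite gt_eqF.
by rewrite ler_wpM2l// ltW.
Qed.

Lemma sublinear_norm {R : realType} (u : nat -> R) :
  sublinear u -> sublinear (fun n => `|u n|).
Proof. by apply: sublinear_le => n; rewrite normr_id. Qed.

Lemma sublinear_sum {R : realType} {T : finType} (P : pred T)
    (u : T -> nat -> R) :
  (forall t, P t -> sublinear (u t)) ->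
  sublinear (fun n => \sum_(t | P t) u t n).
Proof.
move=> hu.
have -> : (fun n => \sum_(t | P t) u t n) =
    \big[(fun f g n => f n + g n)/(fun=> 0)]_(t | P t) u t.
  apply/funext => n; elim/big_rec2: _ => //= t y1 y2 _ ->; by [].
elim/big_ind: _ => //.
  by apply: (@sublinear_bounded _ _ 0) => n; rewrite normr0.
exact: sublinearD.
Qed.

(** Either [|u n| <= e * n], or [e * n < |u n|], and then [e * u n ^ 2 <= K * e * n <= K * |u n|]
    yields [|u n| <= K / e]. *)
Lemma sublinear_sqr {R : realType} (u : nat -> R) (K : R) :
  (forall n, u n ^+ 2 <= K * n%:R) -> sublinear u.
Proof.
move=> hK e e0.
have K0 : 0 <= K by have := hK 1; have := sqr_ge0 (u 1); rewrite mulr1; lra.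
exists (K / e) => n.
have h0 : 0 <= K / e by rewrite divr_ge0// ltW.
have n0 : (0 : R) <= n%:R by [].
have x0 := normr_ge0 (u n).
have := hK n; rewrite -real_normK ?num_real//; set x := `|u n| in x0 * => h.
have [xe|xe] := leP x (e * n%:R); first by lra.
suff : x <= K / e by have := mulr_ge0 (ltW e0) n0; lra.
rewrite ler_pdivlMr//.
have xp : 0 < x by apply: le_lt_trans xe; rewrite mulr_ge0// ltW.
rewrite -(ler_pM2l xp).
have : K * (e * n%:R) <= K * x by rewrite ler_wpM2l// ltW.
have : e * x ^+ 2 <= e * (K * n%:R) by rewrite ler_wpM2l// ltW.
rewrite expr2; lra.
Qed.

Lemma sum_indicator {R : realType} {T : finType} (P : pred T) (x : T) :
  \sum_(t | P t) (x == t)%:R = (P x)%:R :> R.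
Proof.
rewrite big_mkcond (bigD1 x)//= eqxx big1; first by case: ifP; rewrite addr0.
by move=> t /negbTE; rewrite eq_sym => ->; case: ifP.
Qed.

(** * Greedy walks and their Dirichlet energy *)

Section BalancedWalk.
Context {R : realType} {V E : finType} (src tgt : E -> V) (p : E -> R) (v0 : V).
Hypothesis p_gt0 : forall e, 0 < p e.
Hypothesis p_sum : \sum_e p e = 1.
Hypothesis p_flow : forall v, \sum_(e | src e == v) p e = \sum_(e | tgt e == v) p e.
Hypothesis out_edge : forall v, exists e, src e = v.
(** Connectedness in the form in which it is applied: an equivalence relation joining the ends of
    every edge is total. The relation used is that two normalized visit counts differ by o(n). *)
Hypothesis connected : forall r : V -> V -> Prop,
  (forall u, r u u) -> (forall u v, r u v -> r v u) ->
  (forall u v w, r u v -> r v w -> r u w) ->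
  (forall e, r (src e) (tgt e)) -> forall u v, r u v.

Let P v := \sum_(e | src e == v) p e.
Let out (N : E -> R) v := \sum_(e | src e == v) N e.

Let P_gt0 v : 0 < P v.
Proof.
have [e ev] := out_edge v; rewrite /P (bigD1 e)/=; last by rewrite ev.
by rewrite ltr_pwDl// sumr_ge0// => i _; exact: ltW.
Qed.

(** The state [x] holds the current vertex and the edge counts so far. Over the edges leaving that
    vertex, the differences of the two sides sum to zero, so they cannot all be positive. *)
Let next_edge (x : V * (E -> R)) :
  exists e, src e = x.1 /\ x.2 e * P x.1 <= p e * out x.2 x.1.
Proof.
case: x => v N /=; apply: contrapT => H.
have lt0 e : src e == v -> 0 < N e * P v - p e * out N v.
  move=> /eqP ev; rewrite subr_gt0 ltNge; apply/negP => le; apply: H; by exists e.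
have : \sum_(e | src e == v) (N e * P v - p e * out N v) = 0.
  by rewrite sumrB -!mulr_suml mulrC subrr.
move/eqP; rewrite psumr_eq0; last by move=> e /lt0/ltW.
have [e ev] := out_edge v => /allP /(_ e); rewrite mem_index_enum ev eqxx/=.
by move=> /(_ isT); rewrite gt_eqF// lt0// ev.
Qed.

Lemma balanced_walk : exists w : nat -> E,
  [/\ src (w 0%N) = v0, (forall i, src (w i.+1) = tgt (w i)) &
      forall e, sublinear
        (fun n => \sum_(i < n) (w i == e)%:R - n%:R * p e : R)].
Proof.
have [next nextP] := choice next_edge.
pose step (x : V * (E -> R)) :=
  (tgt (next x), fun e => x.2 e + (next x == e)%:R).
pose st n := iter n step (v0, fun=> 0).
pose w n := next (st n).
pose N n e : R := \sum_(i < n) (w i == e)%:R.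
have stN n : (st n).2 = N n.
  apply/funext => e; rewrite /N; elim: n => [|n IH]; first by rewrite big_ord0.
  by rewrite big_ord_recr/= -IH.
have wsrc n : src (w n) = (st n).1 by exact: (nextP _).1.
have wtgt n : (st n.+1).1 = tgt (w n) by [].
have NS n e : N n.+1 e = N n e + (w n == e)%:R by rewrite /N big_ord_recr.
have sum1 (f : E -> V) v e0 :
    \sum_(e | f e == v) (e0 == e)%:R = (f e0 == v)%:R :> R.
  exact: (sum_indicator (fun e => f e == v)).
have N0 n e : 0 <= N n e by rewrite sumr_ge0.
have out0 n v : 0 <= out (N n) v by exact: sumr_ge0.
have outS n v : out (N n.+1) v = out (N n) v + (src (w n) == v)%:R.
  by rewrite /out (eq_bigr _ (fun e _ => NS n e)) big_split/= sum1.
(* N_e overshoots its expected share of the visits to its source by at most 1. *)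
have greedy n e : N n e * P (src e) <= p e * out (N n) (src e) + P (src e).
  elim: n => [|n IH].
    rewrite [N 0%N e]big_ord0 mul0r addr_ge0 ?(ltW (P_gt0 _))//.
    by rewrite mulr_ge0// ltW.
  rewrite NS outS mulrDl mulrDr.
  have [<-|we] := eqVneq (w n) e.
    rewrite eqxx !mulr1 mul1r.
    have := (nextP (st n)).2; rewrite -/(w n) stN -wsrc.
    by have := ltW (p_gt0 (w n)); lra.
  rewrite mul0r addr0; apply: (le_trans IH); rewrite lerD2r lerDl.
  by rewrite mulr_ge0 ?(ltW (p_gt0 _)).
(* Arrivals and departures at a vertex balance, apart from the start of the walk and its current
   position. *)
have inflow n v : \sum_(e | tgt e == v) N n e =
    out (N n) v + ((st n).1 == v)%:R - (v0 == v)%:R.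
  elim: n => [|n IH].
    rewrite /out !big1 ?add0r ?subrr// => e _; by rewrite /N big_ord0.
  rewrite (eq_bigr _ (fun e _ => NS n e)) big_split/= IH outS sum1 wsrc; lra.
have Nsum n : \sum_e N n e = n%:R.
  rewrite /N exchange_big/= (eq_bigr (fun=> 1)) ?sumr_const ?card_ord// => i _.
  rewrite (bigD1 (w i))//= eqxx big1 ?addr0// => e /negbTE.
  by rewrite eq_sym => ->.
pose f v n : R := out (N n) v / P v.
have f0 v n : 0 <= f v n by rewrite divr_ge0// ltW.
have Pf v n : P v * f v n = out (N n) v.
  by rewrite /f mulrCA divff ?mulr1// gt_eqF.
have out_n n v : out (N n) v <= n%:R.
  by rewrite -Nsum [leRHS](bigID (fun e => src e == v))/= lerDl sumr_ge0.
have fn v n : f v n <= (P v)^-1 * n%:R.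
  by rewrite /f mulrC ler_wpM2l// invr_ge0 ltW.
(* Expand the square. By [p_flow] both pure terms equal the sum of [P v * f v n ^+ 2] ([S1], [S2]).
   By [greedy] the cross term is at least the arrivals weighted by [f], up to the sum of
   [f (tgt e) n] ([S3]); by [inflow] these arrivals give the same pure term again, up to the sum of
   [f v n] ([S4], [S5]). *)
have energy n : \sum_e p e * (f (src e) n - f (tgt e) n) ^+ 2 <=
    2 * (\sum_v f v n + \sum_e f (tgt e) n).
  have S1 : \sum_e p e * f (src e) n ^+ 2 = \sum_v P v * f v n ^+ 2.
    rewrite (partition_big src xpredT)//=; apply: eq_bigr => v _.
    by rewrite /P mulr_suml; apply: eq_bigr => e /eqP ->.
  have S2 : \sum_e p e * f (tgt e) n ^+ 2 = \sum_v P v * f v n ^+ 2.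
    rewrite (partition_big tgt xpredT)//=; apply: eq_bigr => v _.
    by rewrite /P p_flow mulr_suml; apply: eq_bigr => e /eqP ->.
  have S3 : \sum_e (N n e - 1) * f (tgt e) n <=
            \sum_e p e * f (src e) n * f (tgt e) n.
    apply: ler_sum => e _; rewrite ler_wpM2r// /f mulrA lerBlDr.
    rewrite -(ler_pM2r (P_gt0 (src e))) mulrDl mul1r divfK ?gt_eqF//.
  have S4 : \sum_e N n e * f (tgt e) n =
      \sum_v (out (N n) v + ((st n).1 == v)%:R - (v0 == v)%:R) * f v n.
    rewrite (partition_big tgt xpredT)//=; apply: eq_bigr => v _.
    by rewrite -inflow mulr_suml; apply: eq_bigr => e /eqP ->.
  have S5 : \sum_v (P v * f v n ^+ 2 - f v n) <=
      \sum_v (out (N n) v + ((st n).1 == v)%:R - (v0 == v)%:R) * f v n.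
    apply: ler_sum => v _; rewrite -Pf expr2 mulrA -[X in _ - X]mul1r -mulrBl.
    by rewrite ler_wpM2r//; case: eqP; case: eqP => _ _ /=; lra.
  have -> : \sum_e p e * (f (src e) n - f (tgt e) n) ^+ 2 =
      \sum_e p e * f (src e) n ^+ 2 + \sum_e p e * f (tgt e) n ^+ 2
      - 2 * \sum_e p e * f (src e) n * f (tgt e) n.
    by rewrite mulr_sumr -big_split -sumrB; apply: eq_bigr => e _ /=; ring.
  have E6 : \sum_e (N n e - 1) * f (tgt e) n =
            \sum_e N n e * f (tgt e) n - \sum_e f (tgt e) n.
    by rewrite -sumrB; apply: eq_bigr => e _; ring.
  move: S5 S3; rewrite sumrB E6 S4 S1 S2; lra.
(* One term of the energy is at most the whole, and [fn] makes the whole at most [K * n]. *)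
have edge e : sublinear (fun n => f (src e) n - f (tgt e) n).
  pose K := 2 * (\sum_v (P v)^-1 + \sum_e (P (tgt e))^-1).
  apply: (@sublinear_sqr _ _ (K / p e)) => n.
  rewrite mulrAC ler_pdivlMr// mulrC.
  apply: le_trans (_ : \sum_e p e * (f (src e) n - f (tgt e) n) ^+ 2 <= _).
    rewrite [leRHS](bigD1 e)//= lerDl sumr_ge0// => i _.
    by rewrite mulr_ge0 ?sqr_ge0// ltW.
  apply: (le_trans (energy n)); rewrite /K -mulrA ler_pM2l// mulrDl !mulr_suml.
  by apply: lerD; apply: ler_sum => i _; exact: fn.
have equi u v : sublinear (fun n => f u n - f v n).
  apply: (connected (fun u v => sublinear (fun n => f u n - f v n))) => //.
  - by move=> u'; apply: (@sublinear_bounded _ _ 0) => n; rewrite subrr normr0.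
  - by move=> u' v'; apply: sublinear_le => n; rewrite distrC.
  - move=> x y z /sublinearD h /h; apply: sublinear_le => n.
    by rewrite subrKA.
have Psum : \sum_v P v = 1 by rewrite -p_sum [RHS](partition_big src xpredT).
(* The average of the [f v n] with weights [P v] is exactly [n], because all departures together
   number [n]. *)
have fcvg u : sublinear (fun n => f u n - n%:R).
  have /sublinear_sum : forall v, xpredT v ->
      sublinear (fun n => P v * (f u n - f v n)).
    by move=> v _; apply: sublinearZ.
  apply: sublinear_le => n.
  under [in leRHS]eq_bigr do rewrite mulrBr Pf.
  rewrite sumrB -mulr_suml Psum mul1r -Nsum.
  by rewrite [in leLHS](partition_big src xpredT).
(* [greedy] bounds the deviation of [N n e] from [n * p e] only from above, by [g e n]. The
   deviations sum to zero over all edges, so each is also at least minus the sum of the other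
   bounds. *)
pose g e n : R := `|p e * (f (src e) n - n%:R)| + 1.
have gs e : sublinear (g e).
  apply: sublinearD; first exact/sublinear_norm/sublinearZ.
  by apply: (@sublinear_bounded _ _ 1) => n; rewrite normr1.
have Dg n e : N n e - n%:R * p e <= g e n.
  apply: (@le_trans _ _ (p e * (f (src e) n - n%:R) + 1)); last first.
    by rewrite lerD2r ler_norm.
  suff : N n e <= p e * f (src e) n + 1 by lra.
  by rewrite -(ler_pM2r (P_gt0 (src e))) /f mulrDl mul1r mulrA divfK ?gt_eqF.
exists w; split => [||e].
- by rewrite wsrc.
- by move=> i; rewrite wsrc wtgt.
have : sublinear (fun n => \sum_e g e n) by apply: sublinear_sum => i _.
apply: sublinear_le => n.
have g0 i : 0 <= g i n by rewrite addr_ge0.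
rewrite -/(N n e) (ger0_norm (sumr_ge0 _ _))// (bigD1 e)//=.
have D0 : \sum_i (N n i - n%:R * p i) = 0.
  by rewrite sumrB Nsum -mulr_sumr p_sum mulr1 subrr.
have : \sum_(i | i != e) (N n i - n%:R * p i) <= \sum_(i | i != e) g i n.
  exact: ler_sum.
move: D0; rewrite (bigD1 e)//= => D0 Dle.
have := Dg n e; have := g0 e.
have : 0 <= \sum_(i | i != e) g i n by exact: sumr_ge0.
rewrite ler_norml; lra.
Qed.

End BalancedWalk.

(** * Neighbourhoods in product spaces *)

Lemma cvg_prod_topology {I : eqType} {K : I -> topologicalType}
    (F : set_system (prod_topology K)) (f : prod_topology K) :
  Filter F -> (forall i, (fun g : prod_topology K => g i) @ F --> f i) ->
  F --> f.
Proof.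
move=> FF H; apply/cvg_sup => i U.
have /= -> := @nbhsE (initial_topology (proj i)) f.
case=> B [[C oC <- Cf]] /filterS; apply.
by apply: (H i); apply: open_nbhs_nbhs.
Qed.

Lemma nbhs_vec {R : realType} {S : finType} (eta : vec R S) (U : set (vec R S)) :
  nbhs eta U <->
  exists2 e : R, 0 < e & forall y : vec R S, (forall s, `|y s - eta s| < e) -> U y.
Proof.
pose B (e : R) := [set y : vec R S | forall s, `|y s - eta s| < e].
have FF : Filter (filter_from [set e : R | 0 < e] B).
  apply: filter_from_filter; first by exists 1 => /=.
  move=> i j /= i0 j0; exists (Num.min i j); first by rewrite /= lt_min i0.
  by move=> y By; split => s; have := By s; rewrite lt_min => /andP[].
split=> [Ue|[e e0 eU]].
  suff : filter_from [set e : R | 0 < e] B --> eta by move=> /(_ U Ue).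
  apply: cvg_prod_topology => s; apply/cvgrPdist_lt => e e0.
  by exists e => // y /(_ s); rewrite distrC.
have H s : nbhs eta [set y : vec R S | `|y s - eta s| < e].
  have Hs : nbhs (eta s : R) [set r : R | `|r - eta s| < e].
    by apply/nbhs_ballP; exists e => //= r; rewrite /ball/= distrC.
  exact: (@proj_continuous S (fun=> R) s eta _ Hs).
exact: filterS eU (@filter_forall _ S _ _ (nbhs_filter eta) H).
Qed.

Lemma nbhs_cantor (f : cantor_space) (U : set cantor_space) :
  nbhs f U <->
  exists n, forall g : cantor_space, (forall i, (i < n)%N -> g i = f i) -> U g.
Proof.
pose B n := [set g : cantor_space | forall i, (i < n)%N -> g i = f i].
have FF : Filter (filter_from setT B).
  apply: filter_from_filter; first by exists 0%N.
  move=> i j _ _; exists (maxn i j) => // g Bg; split => k kl; apply: Bg;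
    by rewrite leq_max kl ?orbT.
split=> [Uf|[n nU]].
  suff : filter_from setT B --> f by move=> /(_ U Uf) [n _ nU]; exists n.
  apply: cvg_prod_topology => i V Vfi.
  exists i.+1 => // g /(_ i (ltnSn i)) gi; rewrite /= gi.
  exact: nbhs_singleton.
have H (i : 'I_n) : nbhs f [set g : cantor_space | g i = f i].
  have /(_ f) := @proj_continuous nat (fun=> bool) i.
  by move=> /(_ [set f i]); apply; exact: discrete_set1.
apply: filterS (@filter_forall _ _ _ _ (nbhs_filter f) H) => g gf.
by apply: nU => i ni; exact: gf (Ordinal ni).
Qed.

(** * Meager ideals *)

(** Otherwise every sequence agreeing with [f] below [n] would lie in the closure of [F], which
    would put [f] in its interior. *)
Lemma nowhere_dense_cylinder (F : set cantor_space) (f : cantor_space) (n : nat) :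
  nowhere_dense_set F -> exists (g : cantor_space) (m : nat),
    [/\ (n < m)%N, forall i, (i < n)%N -> g i = f i &
        forall h : cantor_space, (forall i, (i < m)%N -> h i = g i) -> ~ F h].
Proof.
move=> F0; apply: contrapT => H.
have : (interior (closure F)) f.
  apply/nbhs_cantor; exists n => g gf U /nbhs_cantor[m mU].
  apply: contrapT => FU; apply: H; exists g, (maxn n.+1 m).
  split => // [|h hg Fh]; first by rewrite leq_max leqnn.
  apply: FU; exists h; split => //; apply: mU => i im; apply: hg.
  by rewrite leq_max im orbT.
by rewrite F0.
Qed.

(** A single block has to serve every prefix of length [n] and every [F i] with [i < k]. These are
    finitely many pairs; the pattern is lengthened for one pair at a time, and what was avoided
    before stays avoided. *)
Lemma nowhere_dense_pattern (F : nat -> set cantor_space) (k n : nat) :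
  (forall i, nowhere_dense_set (F i)) ->
  exists (m : nat) (sigma : nat -> bool), (n < m)%N /\
    forall i (h : cantor_space), (i < k)%N ->
      (forall l, (n <= l < m)%N -> h l = sigma l) -> ~ F i h.
Proof.
move=> nd.
suff [m [sg [nm H]]] : exists (m : nat) (sigma : nat -> bool), (n < m)%N /\
    forall z, z \in enum {: 'I_k * {ffun 'I_n -> bool}} ->
    forall h : cantor_space, (forall l : 'I_n, h l = z.2 l) ->
      (forall l, (n <= l < m)%N -> h l = sigma l) -> ~ F z.1 h.
  exists m, sg; split => // i h ik hl.
  apply: (H (Ordinal ik, [ffun l : 'I_n => h l])) => //; first exact: mem_enum.
  by move=> l; rewrite /= ffunE.
elim: (enum _) => [|z s [m [sg [nm IH]]]]; first by exists n.+1, (fun=> false).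
pose f : cantor_space :=
  fun l => if insub l is Some l' then z.2 l' else sg l.
have [g [m' [mm' gf Fg]]] := nowhere_dense_cylinder _ f m (nd z.1).
exists m', g; split; first exact: ltn_trans nm mm'.
have gsg l : (n <= l < m)%N -> g l = sg l.
  by move=> /andP[nl lm]; rewrite gf// /f insubF// ltnNge nl.
move=> y; rewrite inE => /orP[/eqP -> h hz hg|ys h hy hg].
  apply: Fg => l lm'; have [nl|ln] := leqP n l; first by rewrite hg// nl.
  rewrite (hz (Ordinal ln)) gf ?(ltn_trans ln)// /f.
  case: insubP => [l' _ ll|]; last by rewrite ln.
  by rewrite (_ : Ordinal ln = l')//; apply: val_inj; rewrite ll.
apply: (IH y ys h hy) => l /andP[nl lm]; rewrite -gsg ?nl//.
by apply: hg; rewrite nl (ltn_trans lm).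
Qed.

(* A set containing infinitely many of the intervals has a subset that follows
   the patterns [sigma] there, hence that avoids every nowhere dense piece. *)
Lemma talagrand (I : set (set nat)) :
  ideal_on_nat I -> meager_ideal I ->
  exists m : nat -> nat, (forall j, (m j < m j.+1)%N) /\
    forall X, (forall M, exists j, (M <= j)%N /\
                 forall i, (m j <= i < m j.+1)%N -> X i) -> ~ I X.
Proof.
move=> [_ Isub _ _] [F [nd IF]].
have step (x : nat * nat) : exists y : nat * (nat -> bool), (x.2 < y.1)%N /\
    forall i (h : cantor_space), (i < x.1)%N ->
      (forall l, (x.2 <= l < y.1)%N -> h l = y.2 l) -> ~ F i h.
  have [m [sg H]] := nowhere_dense_pattern F x.1 x.2 nd; by exists (m, sg).
have [next nextP] := choice step.
pose m := fix m j := if j is j'.+1 then (next (j', m j')).1 else 0%N.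
pose sg j := (next (j, m j)).2.
have mS j : (m j < m j.+1)%N by have [] := nextP (j, m j).
exists m; split => // X HX IX.
have mono : {homo m : i j / (i <= j)%N}.
  exact: (homo_leq leqnn leq_trans (fun i => ltnW (mS i))).
have uniq_j j j' l : (m j <= l < m j.+1)%N -> (m j' <= l < m j'.+1)%N -> j = j'.
  move=> /andP[jl lj] /andP[jl' lj']; apply/eqP; rewrite eqn_leq.
  by apply/andP; split; rewrite leqNgt; apply/negP => /mono; lia.
pose J := [set j | forall i, (m j <= i < m j.+1)%N -> X i].
pose h : cantor_space :=
  fun l => `[< exists j, [/\ J j, (m j <= l < m j.+1)%N & sg j l] >].
have hX : [set n | h n = true] `<=` X.
  by move=> l /= /asboolP [j [Jj lj _]]; exact: Jj.
have [n _ Fn] := IF h (Isub _ _ hX IX).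
(* The pattern on block [j] avoids every [F i] with [i < j], so a block beyond [n] is needed to
   contradict [F n h]. *)
have [j [nj Jj]] := HX n.+1.
apply: (nextP (j, m j)).2 Fn => //= l lj.
apply/idP/idP => [/asboolP[j' [_ lj' s]]|s]; first by rewrite (uniq_j _ _ _ lj lj').
by apply/asboolP; exists j.
Qed.

(** * Digit expansions *)

(** Horner evaluation starting at index 1: the numerator over [b ^ n] of the n-th partial sum of the
    expansion. *)
Fixpoint digits_val (b : nat) (d : nat -> nat) (n : nat) : nat :=
  if n is n'.+1 then (b * digits_val b d n' + d n)%N else 0%N.

Lemma digits_val_inj (b : nat) (d d' : nat -> nat) (n : nat) :
  (forall i, (d i < b)%N) -> (forall i, (d' i < b)%N) ->
  digits_val b d n = digits_val b d' n ->
  forall i, (0 < i <= n)%N -> d i = d' i.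
Proof.
move=> db d'b; elim: n => [|n IH] /= eqv i; first by lia.
have b0 : (0 < b)%N by apply: leq_ltn_trans (db 0%N).
have eqn : digits_val b d n = digits_val b d' n.
  have := congr1 (divn^~ b) eqv.
  by rewrite ![(b * _)%N]mulnC !divnMDl// !divn_small// !addn0.
have [->|ni] := eqVneq i n.+1.
  by move: eqv; rewrite eqn => /addnI.
by move=> ilt; apply: IH => //; lia.
Qed.

Lemma eq_digits_val (b : nat) (d d' : nat -> nat) (n : nat) :
  (forall i, (0 < i <= n)%N -> d i = d' i) ->
  digits_val b d n = digits_val b d' n.
Proof.
elim: n => //= n IH h; rewrite h ?leqnn// IH// => i /andP[i0 il].
by apply: h; rewrite i0 ltnW.
Qed.

Lemma digits_val_surj (b n v : nat) : (v < b ^ n)%N ->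
  exists d, (forall i, (0 < b)%N -> (d i < b)%N) /\ digits_val b d n = v.
Proof.
elim: n v => [|n IH] v.
  by rewrite expn0 ltnS leqn0 => /eqP ->; exists (fun=> 0%N).
have [->|b0] := posnP b; first by rewrite exp0n.
rewrite expnS => vlt.
have [|d [db dv]] := IH (v %/ b)%N; first by rewrite ltn_divLR// mulnC.
exists (fun i => if (i <= n)%N then d i else (v %% b)%N); split.
  by move=> i _; case: ifP => _; [exact: db|rewrite ltn_mod].
rewrite /= ltnn (@eq_digits_val _ _ d); first by rewrite dv mulnC -divn_eq.
by move=> i /andP[_ ->].
Qed.

Lemma digits_val_sum {R : realType} (b : nat) (d : nat -> nat) (n : nat) :
  (0 < b)%N ->
  \sum_(1 <= i < n.+1) (d i)%:R / b%:R ^+ i =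
    (digits_val b d n)%:R / b%:R ^+ n :> R.
Proof.
move=> b0; elim: n => [|n IH]; first by rewrite big_geq// mul0r.
rewrite big_nat_recr//= IH natrD natrM exprS.
by field; rewrite expf_neq0 pnatr_eq0 -lt0n b0.
Qed.

(** Appending [k] digits multiplies the value by [b ^ k] and adds less than [b ^ k]; hence the
    b-adic intervals are nested. *)
Lemma digits_val_addn {R : realType} (b : nat) (d : nat -> nat) (n k : nat) :
  (forall i, (d i < b)%N) ->
  (digits_val b d n)%:R / b%:R ^+ n <=
    (digits_val b d (n + k))%:R / b%:R ^+ (n + k) :> R /\
  ((digits_val b d (n + k))%:R + 1) / b%:R ^+ (n + k) <=
    ((digits_val b d n)%:R + 1) / b%:R ^+ n :> R.
Proof.
move=> db.
have b0 : 0 < b%:R :> R by rewrite ltr0n (leq_ltn_trans _ (db 0%N)).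
suff H : ((digits_val b d n * b ^ k <= digits_val b d (n + k))%N /\
         (digits_val b d (n + k) < (digits_val b d n).+1 * b ^ k)%N).
  have E (a : R) : a / b%:R ^+ n = a * b%:R ^+ k / (b%:R ^+ n * b%:R ^+ k).
    by field; rewrite !expf_neq0 ?gt_eqF.
  rewrite exprD !E !ler_pM2r ?invr_gt0 ?mulr_gt0 ?exprn_gt0// !natr1.
  by rewrite -natrX -!natrM !ler_nat.
elim: k => [|k [IH1 IH2]]; first by rewrite addn0 expn0 !muln1.
rewrite addnS /= expnS; have := db (n + k).+1; split; nia.
Qed.

Lemma nonterm_expansion_bounds {R : realType} (b : nat) (x : R)
    (d : nat -> nat) (n : nat) :
  nonterm_expansion b x d ->
  (digits_val b d n)%:R / b%:R ^+ n <= x <=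
    ((digits_val b d n)%:R + 1) / b%:R ^+ n.
Proof.
move=> [_ db dx _].
have b0 : (0 < b)%N by rewrite (leq_ltn_trans _ (db 0%N)).
have dx' : (fun N => (digits_val b d N)%:R / b%:R ^+ N : R) @ \oo --> x.
  by move: dx; under eq_fun do rewrite digits_val_sum//.
apply/andP; split.
  rewrite -(cvg_lim (@Rhausdorff R) dx'); apply: limr_ge; first exact: cvgP dx'.
  near=> k.
  have -> : k = (n + (k - n))%N by rewrite subnKC//; near: k; exact: nbhs_infty_ge.
  by have [] := @digits_val_addn R b d n (k - n) db.
rewrite -(cvg_lim (@Rhausdorff R) dx'); apply: limr_le; first exact: cvgP dx'.
near=> k.
have -> : k = (n + (k - n))%N by rewrite subnKC//; near: k; exact: nbhs_infty_ge.
have [_] := @digits_val_addn R b d n (k - n) db; apply: le_trans.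
by rewrite ler_pM2r ?invr_gt0 ?exprn_gt0 ?ltr0n// lerDl.
Unshelve. all: by end_near. Qed.

Lemma nonterm_expansion_exists {R : realType} (b : nat) (x : R) :
  (2 <= b)%N -> 0 < x <= 1 -> exists d, nonterm_expansion b x d.
Proof.
move=> b2 /andP[x0 x1].
have b0 : 0 < b%:R :> R by rewrite ltr0n ltnW.
have bn0 n : 0 < b%:R ^+ n :> R by rewrite exprn_gt0.
(* [c n] is the ceiling of [b ^ n * x], minus one. The strict inequality on the left is what rules
   out a terminating expansion. *)
have /choice [c cP] : forall n, exists c : nat,
    c%:R < b%:R ^+ n * x /\ b%:R ^+ n * x <= c%:R + 1.
  move=> n; have y0 : 0 < b%:R ^+ n * x by rewrite mulr_gt0.
  have ex : exists c : nat, b%:R ^+ n * x <= c%:R.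
    by exists (Num.bound (b%:R ^+ n * x)); exact/ltW/archi_boundP/ltW.
  have [c yc cmin] := ex_minnP ex.
  case: c yc cmin => [|c] yc cmin; first by move: y0; rewrite ltNge yc.
  exists c; rewrite natr1 yc; split => //; rewrite ltNge; apply/negP => /cmin.
  by rewrite ltnn.
have c0 : c 0%N = 0%N.
  have [] := cP 0%N; rewrite expr0 mul1r => h _.
  by have := lt_le_trans h x1; rewrite ltrn1; lia.
have cS n : (b * c n <= c n.+1 < b * c n + b)%N.
  have [h1 h2] := cP n; have [] := cP n.+1; rewrite exprS -mulrA => h3 h4.
  apply/andP; split.
    rewrite -ltnS -(ltr_nat R) natrM -natr1; apply: lt_le_trans h4.
    by rewrite ltr_pM2l.
  rewrite -(ltr_nat R) natrD natrM; apply: (lt_le_trans h3).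
  by rewrite -[X in _ + X]mulr1 -mulrDr ler_pM2l.
pose d n : nat := if n is n'.+1 then (c n - b * c n')%N else 0%N.
have dv n : digits_val b d n = c n.
  by elim: n => //= n ->; rewrite subnKC//; have /andP[] := cS n.
exists d; split => //.
- by case=> [|n] /=; [exact: ltnW|have := cS n; lia].
- under eq_fun do rewrite digits_val_sum ?dv 1?ltnW//.
  have hlim : (fun n => x - (b%:R^-1 : R) ^+ n) @ \oo --> x.
    rewrite -[X in _ --> X]subr0; apply: cvgB; first exact: cvg_cst.
    apply: cvg_expr; rewrite ger0_norm ?invr_ge0 ?ltW// invf_lt1//.
    by rewrite ltr1n.
  apply: (squeeze_cvgr _ hlim (cvg_cst x)); near=> n.
  have [h1 h2] := cP n; rewrite ler_pdivlMr// ler_pdivrMr// exprVn mulrBl.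
  by rewrite mulVf ?gt_eqF//; apply/andP; split; lra.
(* If all digits beyond [N] vanished, [c (N + k)] would be [b ^ k * c N], and the positive number
   [b ^ N * x - c N] would be at most [b ^ (-k)] for every [k]. *)
- move=> N; apply: contrapT => H.
  have dN n : (N < n)%N -> d n = 0%N.
    by move=> Nn; apply: contrapT => dn; apply: H; exists n.
  have cN k : c (N + k)%N = (b ^ k * c N)%N.
    elim: k => [|k IH]; first by rewrite addn0 mul1n.
    have cd n : c n.+1 = (b * c n + d n.+1)%N.
      by rewrite subnKC//; have /andP[] := cS n.
    rewrite addnS cd dN ?addn0 ?IH ?expnS ?mulnA//.
    by rewrite ltnS leq_addr.
  have [h _] := cP N.
  have h0 : 0 < b%:R ^+ N * x - (c N)%:R by rewrite subr_gt0.
  have /cvgrPdist_lt : (fun n => (b%:R^-1 : R) ^+ n) @ \oo --> (0 : R).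
    apply: cvg_expr; rewrite ger0_norm ?invr_ge0 ?ltW// invf_lt1//.
    by rewrite ltr1n.
  move=> /(_ _ h0) [k _ /(_ k (leqnn k))] /=.
  rewrite sub0r normrN ger0_norm ?exprn_ge0 ?invr_ge0 ?ltW//.
  rewrite exprVn ltNge => /negP; apply.
  have [_] := cP (N + k)%N; rewrite cN natrM natrX exprD.
  by move=> h'; rewrite -[leRHS]mul1r ler_pdivlMr//; lra.
Unshelve. all: by end_near. Qed.

Lemma digitP {R : realType} (b : nat) (x : R) :
  (2 <= b)%N -> 0 < x <= 1 -> nonterm_expansion b x (digit b x).
Proof.
by move=> b2 x01; apply: ClassicalEpsilon.epsilon_spec; exact: nonterm_expansion_exists.
Qed.

(** The true digits place [x] in a closed interval of level [n]. As [x] is interior to the interval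
    of [d], each of the two integer numerators is less than the other plus one, so they agree. *)
Lemma digit_cylinder {R : realType} (b : nat) (x : R) (d : nat -> nat) (n : nat) :
  (2 <= b)%N -> 0 < x <= 1 -> (forall i, (d i < b)%N) ->
  (digits_val b d n)%:R / b%:R ^+ n < x < ((digits_val b d n)%:R + 1) / b%:R ^+ n ->
  forall i, (0 < i <= n)%N -> digit b x i = d i.
Proof.
move=> b2 x01 db /andP[h1 h2].
have e := digitP b x b2 x01.
have /andP[h3 h4] := nonterm_expansion_bounds b x (digit b x) n e.
have bn0 : 0 < (b%:R ^+ n)^-1 :> R by rewrite invr_gt0 exprn_gt0// ltr0n ltnW.
apply: digits_val_inj => //; first by case: e.
have := lt_le_trans h1 h4; rewrite ltr_pM2r// natr1 ltr_nat.
have := le_lt_trans h3 h2; rewrite ltr_pM2r// natr1 ltr_nat; lia.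
Qed.

(** Take [b ^ (-L)] below half of [v - u]: rounding [u] up costs at most one such length, and the
    interval itself takes another. *)
Lemma basic_interval {R : realType} (b : nat) (u v : R) :
  (2 <= b)%N -> 0 <= u -> u < v -> v <= 1 ->
  exists (L m : nat), (m < b ^ L)%N /\
    u <= m%:R / b%:R ^+ L /\ (m%:R + 1) / b%:R ^+ L <= v.
Proof.
move=> b2 u0 uv v1.
have b0 : 0 < b%:R :> R by rewrite ltr0n ltnW.
have uv2 : 0 < (v - u) / 2 by rewrite divr_gt0// subr_gt0.
have /cvgrPdist_lt : (fun n => (b%:R^-1 : R) ^+ n) @ \oo --> (0 : R).
  apply: cvg_expr; rewrite ger0_norm ?invr_ge0 ?ltW// invf_lt1//.
  by rewrite ltr1n.
move=> /(_ _ uv2) [L _ /(_ L (leqnn L))] /=.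
rewrite sub0r normrN ger0_norm ?exprn_ge0 ?invr_ge0 ?ltW// exprVn => hL.
have bL : 0 < b%:R ^+ L :> R by rewrite exprn_gt0.
have y0 : 0 <= b%:R ^+ L * u by rewrite mulr_ge0// ltW.
have ex : exists c : nat, b%:R ^+ L * u <= c%:R.
  by exists (Num.bound (b%:R ^+ L * u)); exact/ltW/archi_boundP.
have [m um mmin] := ex_minnP ex.
have mle : m%:R <= b%:R ^+ L * u + 1.
  case: m um mmin => [|m] um mmin; first by lra.
  rewrite -natr1 lerD2r leNgt; apply/negP => h.
  by have := mmin m (ltW h); rewrite ltnn.
have key : (m%:R + 1) / b%:R ^+ L <= v.
  rewrite ler_pdivrMr//.
  have : 1 < b%:R ^+ L * ((v - u) / 2).
    by rewrite -(ltr_pM2l bL) mulfV ?gt_eqF in hL.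
  lra.
exists L, m; split; last by rewrite ler_pdivlMr// mulrC.
have := le_trans key v1; rewrite ler_pdivrMr// mul1r natr1 -natrX ler_nat.
by [].
Qed.

(** * Block frequencies *)

Lemma sublinear_shift {R : realType} (u : nat -> R) (L : nat) :
  sublinear (fun n => u (L + n)%N) -> sublinear u.
Proof.
move=> hu e e0; have [C hC] := hu e e0.
have S0 : 0 <= \sum_(i < L) `|u i| by rewrite sumr_ge0.
exists (`|C| + \sum_(i < L) `|u i|) => n.
have en0 : 0 <= e * n%:R by rewrite mulr_ge0// ltW.
have [nL|Ln] := ltnP n L.
  have : `|u n| <= \sum_(i < L) `|u i|.
    by rewrite (bigD1 (Ordinal nL))//= lerDl sumr_ge0.
  by have := normr_ge0 C; lra.
have := hC (n - L)%N; rewrite subnKC// natrB// mulrBr.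
have : 0 <= e * L%:R by rewrite mulr_ge0// ltW.
by have := ler_norm C; lra.
Qed.

Lemma sublinear_cvg {R : realType} (u : nat -> R) :
  sublinear u -> u n.+1 / n.+1%:R @[n --> \oo] --> (0 : R).
Proof.
move=> hu; apply/cvgrPdist_lt => e e0.
have e2 : 0 < e / 2 by rewrite divr_gt0.
have [C hC] := hu _ e2.
have h0 : 0 <= `|C| / (e / 2) by rewrite divr_ge0// ltW.
exists (Num.bound (`|C| / (e / 2))) => // n /= hn.
rewrite sub0r normrN normrM normfV (ger0_norm (ler0n _ n.+1)).
rewrite ltr_pdivrMr ?ltr0n//; apply: (le_lt_trans (hC _)).
have : `|C| / (e / 2) < n.+1%:R.
  by apply: (lt_le_trans (archi_boundP h0)); rewrite ler_nat ltnW.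
by rewrite ltr_pdivrMr//; have := ler_norm C; lra.
Qed.

(** * The de Bruijn graph: [str_init] and [str_tail] give the source and target of an edge *)

Definition str_init {b K : nat} (s : str b K.+1) : str b K :=
  [ffun j => s (widen_ord (leqnSn K) j)].

Definition str_tail {b K : nat} (s : str b K.+1) : str b K :=
  [ffun j => s (lift ord0 j)].

Lemma str_atE {b m : nat} (t : {ffun 'I_m -> 'I_b}) (i : 'I_m) (n : nat) a :
  n = i -> str_at t n a = t i.
Proof. by move=> ->; rewrite /str_at valK. Qed.

Lemma sum_str_cons {R : realType} {b K : nat} (p : str b K.+1 -> R) (t : str b K) :
  \sum_(a : 'I_b) p (@str_cons b K.+1 a t) = \sum_(s | str_tail s == t) p s.
Proof.
rewrite [RHS](reindex_onto (fun a => @str_cons b K.+1 a t) (fun s => s ord0)).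
  apply: eq_bigl => a; apply/esym/andP; split; last by rewrite ffunE.
  apply/eqP/ffunP => j; rewrite !ffunE lift0 /=.
  exact: str_atE.
move=> s /eqP <-; apply/ffunP => j; rewrite ffunE.
case: eqP => [j0|/eqP j0]; first by congr (s _); apply: val_inj.
have jlt : (j.-1 < K)%N by rewrite prednK ?lt0n// -ltnS ltn_ord.
rewrite (str_atE _ (Ordinal jlt))// ffunE; congr (s _); apply: val_inj.
by apply: etrans (lift0 _) _; rewrite /= prednK// lt0n.
Qed.

Lemma sum_str_snoc {R : realType} {b K : nat} (p : str b K.+1 -> R) (t : str b K) :
  \sum_(a : 'I_b) p (@str_snoc b K.+1 t a) = \sum_(s | str_init s == t) p s.
Proof.
rewrite [RHS](reindex_onto (fun a => @str_snoc b K.+1 t a) (fun s => s ord_max)).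
  apply: eq_bigl => a; apply/esym/andP; split; last by rewrite ffunE eqxx.
  apply/eqP/ffunP => j; rewrite !ffunE /= ltn_eqF//.
  exact: str_atE.
move=> s /eqP <-; apply/ffunP => j; rewrite ffunE /=.
case: eqP => [j0|/eqP j0]; first by congr (s _); apply: val_inj.
have jlt : (j < K)%N by rewrite ltn_neqAle j0 -ltnS ltn_ord.
by rewrite (str_atE _ (Ordinal jlt))// ffunE; congr (s _); apply: val_inj.
Qed.

(** The third condition becomes conservation of flow at the vertex [t], the form that
    [balanced_walk] takes. *)
Lemma DeltaE {R : realType} (b K : nat) (p : vec R (str b K.+1)) :
  Delta b K.+1 p <-> [/\ \sum_s p s = 1, (forall s, 0 <= p s) &
    forall t : str b K,
      \sum_(s | str_tail s == t) p s = \sum_(s | str_init s == t) p s].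
Proof.
by split => -[h1 h2 h3]; split => // t; have := h3 t;
  rewrite sum_str_cons sum_str_snoc.
Qed.

(** Sliding a window of length [K] along the concatenation of [u] and [v] traces a path from [u] to
    [v]. *)
Lemma de_bruijn_connected {b K : nat} (r : str b K -> str b K -> Prop) :
  (0 < b)%N -> (forall u, r u u) ->
  (forall u v w, r u v -> r v w -> r u w) ->
  (forall s : str b K.+1, r (str_init s) (str_tail s)) -> forall u v, r u v.
Proof.
move=> b0 rr rt re u v; pose a0 := Ordinal b0.
pose c i := if (i < K)%N then str_at u i a0 else str_at v (i - K)%N a0.
pose W j : str b K := [ffun i : 'I_K => c (i + j)%N].
have rW j : r (W 0%N) (W j).
  elim: j => [//|j IH]; apply: (rt _ _ _ IH).
  pose s : str b K.+1 := [ffun i : 'I_K.+1 => c (i + j)%N].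
  have <- : str_init s = W j by apply/ffunP => i; rewrite !ffunE.
  have <- // : str_tail s = W j.+1.
  by apply/ffunP => i; rewrite !ffunE lift0 addSnnS.
have := rW K.
have -> : W 0%N = u.
  by apply/ffunP => i; rewrite ffunE addn0 /c ltn_ord; exact: str_atE.
have -> // : W K = v.
apply/ffunP => i; rewrite ffunE /c ltnNge leq_addl /= addnK; exact: str_atE.
Qed.

(** * Frequency vectors of an arbitrary digit sequence *)

Definition window {b k : nat} (d : nat -> nat) (i : nat) (s : str b k) : bool :=
  [forall j : 'I_k, d (i.+1 + j)%N == nat_of_ord (s j)].

Definition digit_freq {R : realType} {b k : nat} (d : nat -> nat) (m : nat) :
    vec R (str b k) :=
  fun s => (\sum_(i < m.+1) (window d i s)%:R) / m.+1%:R.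

Lemma pi_seqE {R : realType} (b k : nat) (x : R) :
  pi_seq b k x = digit_freq (digit b x).
Proof.
apply/funext => m; apply/funext => s.
rewrite /pi_seq /freq /digit_freq -natr_sum -sum1_card big_mkcond/=.
by congr (_%:R / _); apply: eq_bigr => i _; rewrite inE /window; case: ifP.
Qed.

Definition str_of {b : nat} {d : nat -> nat} (db : forall i, (d i < b)%N)
    (k i : nat) : str b k := [ffun j : 'I_k => Ordinal (db (i.+1 + j)%N)].

Lemma window_str_of {b k : nat} {d : nat -> nat} (db : forall i, (d i < b)%N)
    (i : nat) (s : str b k) : window d i s = (str_of db k i == s).
Proof.
apply/forallP/eqP => [H|<- j]; last by rewrite ffunE.
by apply/ffunP => j; rewrite ffunE; apply: val_inj; exact/eqP/H.
Qed.

Lemma digit_freq_ge0 {R : realType} {b k : nat} (d : nat -> nat) m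
  (s : str b k) : 0 <= digit_freq (R := R) d m s.
Proof. by rewrite divr_ge0// sumr_ge0. Qed.

Lemma digit_freq_le1 {R : realType} {b k : nat} (d : nat -> nat) m
  (s : str b k) : digit_freq (R := R) d m s <= 1.
Proof.
rewrite ler_pdivrMr ?ltr0n// mul1r -natr_sum ler_nat.
rewrite -[leqRHS]card_ord -sum1_card; apply: leq_sum => i _.
exact: leq_b1.
Qed.

Lemma sum_digit_freq {R : realType} {b k : nat} {d : nat -> nat}
    (db : forall i, (d i < b)%N) m (P : pred (str b k)) :
  \sum_(s | P s) digit_freq (R := R) d m s =
    (\sum_(i < m.+1) (P (str_of db k i))%:R) / m.+1%:R.
Proof.
rewrite -mulr_suml exchange_big/=; congr (_ / _); apply: eq_bigr => i _.
by rewrite -sum_indicator; apply: eq_bigr => s _; rewrite (window_str_of db).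
Qed.

Lemma sum_digit_freq1 {R : realType} {b k : nat} (d : nat -> nat) m :
  (forall i, (d i < b)%N) ->
  \sum_(s : str b k) digit_freq (R := R) d m s = 1.
Proof.
move=> db; rewrite (sum_digit_freq db)/= -natr_sum sum1_card card_ord.
by rewrite divff.
Qed.

(** The tail of one window is the initial part of the next, so the difference telescopes to two
    boundary terms divided by [m.+1]. *)
Lemma digit_freq_flow {R : realType} {b K : nat} (d : nat -> nat) (t : str b K) :
  (forall i, (d i < b)%N) ->
  (\sum_(s | str_tail s == t) digit_freq (R := R) d m s -
   \sum_(s | str_init s == t) digit_freq (R := R) d m s) @[m --> \oo] --> (0 : R).
Proof.
move=> db.
pose g i : R := (str_of db K i == t)%:R.
have init_of i : str_init (str_of db K.+1 i) = str_of db K i.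
  by apply/ffunP => j; rewrite !ffunE; apply: val_inj.
have tail_of i : str_tail (str_of db K.+1 i) = str_of db K i.+1.
  apply/ffunP => j; rewrite !ffunE; apply: val_inj.
  by rewrite /= -[bump 0 j]/(nat_of_ord (lift ord0 j)) lift0 addnS.
have : sublinear (fun m => g m - g 0%N).
  apply: (@sublinear_bounded _ _ 1) => m; rewrite ler_norml /g.
  by do 2!case: eqP => _ /=; lra.
move/sublinear_cvg; apply: cvg_trans; apply: near_eq_cvg; apply: nearW => m.
rewrite !(sum_digit_freq db) -mulrBl; congr (_ / _).
rewrite -sumrB -(telescope_sumr g (leq0n m.+1)) big_mkord.
by apply: eq_bigr => i _; rewrite init_of tail_of.
Qed.

Lemma digit_freq_dense {R : realType} {b K : nat} (p : vec R (str b K.+1))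
    (d0 : nat -> nat) (L : nat) :
  Delta b K.+1 p -> (forall s, 0 < p s) -> (forall i, (d0 i < b)%N) ->
  exists d, [/\ forall i, (d i < b)%N, forall i, (i <= L)%N -> d i = d0 i &
    forall s : str b K.+1, digit_freq d m s @[m --> \oo] --> p s].
Proof.
move=> /DeltaE[p1 _ pflow] p0 d0b.
have b0 : (0 < b)%N := leq_ltn_trans (leq0n _) (d0b 0%N).
pose v0 : str b K := [ffun=> Ordinal b0].
have out (v : str b K) : exists s : str b K.+1, str_init s = v.
  exists (@str_snoc b K.+1 v (Ordinal b0)).
  by apply/ffunP => j; rewrite !ffunE /= ltn_eqF//; exact: str_atE.
have [w [_ wS wfreq]] := balanced_walk str_init str_tail p v0 p0 p1
  (fun v => esym (pflow v)) out
  (fun r rr _ rt re => de_bruijn_connected r b0 rr rt re).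
(* Consecutive edges overlap in [K] letters, so the edge [w n] spells the first letters of [w n],
   ..., [w (n + K)]. *)
have wE j (jK : (j < K.+1)%N) n : w (n + j)%N ord0 = w n (Ordinal jK).
  elim: j jK n => [|j IH] jK n; first by rewrite addn0; congr (w _ _); apply: val_inj.
  rewrite -addSnnS (IH (ltnW jK)).
  have /ffunP/(_ (Ordinal (jK : (j < K)%N))) := wS n; rewrite !ffunE.
  rewrite (_ : widen_ord _ _ = Ordinal (ltnW jK)); last exact: val_inj.
  by move=> ->; congr (w _ _); apply: val_inj.
(* After the prefix, digit [L + 1 + i] is the first letter of [w i]; by [dw] the window at [L + i]
   is then the edge [w i]. *)
pose d i : nat := if (i <= L)%N then d0 i else w (i - L.+1)%N ord0.
have db i : (d i < b)%N by rewrite /d; case: ifP.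
exists d; split => // [i iL|s]; first by rewrite /d iL.
have dw i : str_of db K.+1 (L + i) = w i.
  apply/ffunP => j; rewrite ffunE; apply: val_inj => /=.
  rewrite /d addSn leqNgt ltnS -addnA leq_addr /= subSS addKn.
  by rewrite (wE j (ltn_ord j)); congr (nat_of_ord (w _ _)); apply: val_inj.
have /sublinear_cvg : sublinear
    (fun n => \sum_(i < n) (window d i s)%:R - n%:R * p s : R).
  apply: (@sublinear_shift _ _ L).
  have : sublinear (fun n => (\sum_(i < n) (w i == s)%:R - n%:R * p s : R) +
    (\sum_(i < L) (window d i s)%:R - L%:R * p s)).
    by apply: sublinearD (wfreq s) _; exact: sublinear_bounded.
  apply: sublinear_le => n; rewrite big_split_ord/= natrD mulrDl.
  under [X in `|_ + X - _|]eq_bigr do rewrite (window_str_of db) dw.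
  by rewrite le_eqVlt; apply/orP; left; apply/eqP; congr (`|_|); ring.
move=> h; rewrite (_ : (fun m => _) = (fun m =>
    (\sum_(i < m.+1) (window d i s)%:R - m.+1%:R * p s) / m.+1%:R + p s)).
  by rewrite -[X in _ --> X]add0r; exact: cvgD h (cvg_cst _).
by apply/funext => m; rewrite /digit_freq mulrBl mulrAC divff ?mul1r ?subrK.
Qed.

(** * Regular matrices *)

Definition row_sum {R : realType} (A : nat -> nat -> R) (z : nat -> R) (n : nat)
  : R := lim (series (fun i => A n i * z i) @ \oo).

Lemma regular_matrix_scalar {R : realType} (A : nat -> nat -> R) (z : nat -> R)
    (l : R) :
  regular_matrix A -> z @ \oo --> l -> row_sum A z @ \oo --> l.
Proof.
move=> rA zl.
pose Z i : vec R 'I_1 := fun=> z i; pose eta : vec R 'I_1 := fun=> l.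
have Zeta : Z @ \oo --> eta.
  by apply: cvg_prod_topology => i; exact: zl.
have [_ H] := rA 1%N Z eta Zeta.
exact: cvg_comp H (@proj_continuous 'I_1 (fun=> R) ord0 eta).
Qed.

(* [lim] of a divergent series is [point = 0], so a limit 1 forces the rows to
   be eventually absolutely summable. *)
Lemma rows_summable {R : realType} (A : nat -> nat -> R) :
  (fun n => lim (series (fun i => `|A n i|) @ \oo)) @ \oo --> (1 : R) ->
  exists N, forall n, (N <= n)%N -> cvgn (series (fun i => `|A n i|)).
Proof.
move=> /cvgrPdist_lt /(_ 1 ltr01) [N _ HN]; exists N => n Nn.
apply: contrapT => /dvgP dv; have := HN n Nn; rewrite /= dv.
by rewrite [point]/(0 : R) subr0 normr1 ltxx.
Qed.

Lemma row_cvg {R : realType} (A : nat -> nat -> R) (z : nat -> R) (n : nat) :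
  cvgn (series (fun i => `|A n i|)) -> (forall i, `|z i| <= 1) ->
  cvgn (series (fun i => A n i * z i)).
Proof.
move=> cA z1; apply: normed_cvg; apply: series_le_cvg cA => [i|i|i] //=.
by rewrite normrM ler_piMr.
Qed.

Lemma row_sum_linear {R : realType} {S : finType} (A : nat -> nat -> R)
    (c : S -> R) (z : S -> nat -> R) (n : nat) :
  (forall s, cvgn (series (fun i => A n i * z s i))) ->
  row_sum A (fun i => \sum_s c s * z s i) n = \sum_s c s * row_sum A (z s) n.
Proof.
move=> cz; apply/cvg_lim => //.
rewrite (_ : series _ =
    (fun m => \sum_s c s * series (fun i => A n i * z s i) m)).
  apply: (@cvg_big _ _ +%R 0 xpredT) => [|s _]; first exact: add_continuous.
  by apply: cvgM; [exact: cvg_cst|exact: cz].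
apply/funext => m; rewrite /series/=.
under eq_bigr do rewrite mulr_sumr.
rewrite exchange_big/=; apply: eq_bigr => s _; rewrite mulr_sumr.
by apply: eq_bigr => i _; rewrite mulrCA.
Qed.

(** The left side is minus the total negative part of the row, since [(a - |a|) / 2] is minus the
    negative part of [a]; weights in [0,1] cannot push a term below that. *)
Lemma row_sum_ge {R : realType} (A : nat -> nat -> R) (z : nat -> R) (n : nat) :
  cvgn (series (fun i => `|A n i|)) -> (forall i, 0 <= z i <= 1) ->
  (row_sum A (fun=> 1) n - lim (series (fun i => `|A n i|) @ \oo)) / 2
    <= row_sum A z n.
Proof.
move=> cA z01.
have z1 i : `|z i| <= 1 by have /andP[h1 h2] := z01 i; rewrite ger0_norm.
have c1 : cvgn (series (fun i => A n i * 1)).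
  by apply: (row_cvg _ _ _ cA) => i; rewrite normr1.
have cz := row_cvg _ _ _ cA z1.
have h : series (fun i => (A n i * 1 - `|A n i|) / 2) @ \oo -->
    (row_sum A (fun=> 1) n - lim (series (fun i => `|A n i|) @ \oo)) / 2.
  rewrite (_ : series _ = (fun m => (series (fun i => A n i * 1) m -
      series (fun i => `|A n i|) m) / 2)).
    by apply: cvgM; [apply: cvgB|exact: cvg_cst].
  by apply/funext => m; rewrite /series/= -sumrB mulr_suml.
rewrite -(cvg_lim (@Rhausdorff R) h).
apply: lim_series_le => //; first exact: cvgP h.
move=> i; have /andP[h1 h2] := z01 i; rewrite mulr1.
case: (lerP 0 (A n i)) => Ai.
  by rewrite ger0_norm// subrr mul0r mulr_ge0.
by rewrite ltr0_norm// -subr_ge0; have := mulr_ge0 (ltW (_ : 0 < - A n i)) h1;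
  nra.
Qed.

(** [M] is where the absolute tail of the row drops below [e / 2]; beyond it [z] and [z'] differ by
    at most 1. It depends on the row alone, so it can be fixed before the digits are compared. *)
Lemma row_sum_tail {R : realType} (A : nat -> nat -> R) (n : nat) (e : R) :
  cvgn (series (fun i => `|A n i|)) -> 0 < e ->
  exists M, forall M', (M <= M')%N -> forall z z' : nat -> R,
    (forall i, 0 <= z i <= 1) -> (forall i, 0 <= z' i <= 1) ->
    (forall i, (i < M')%N -> z i = z' i) ->
    `|row_sum A z n - row_sum A z' n| < e.
Proof.
move=> cA e0.
have e2 : 0 < e / 2 by rewrite divr_gt0.
have /cvgrPdist_lt/(_ _ e2) [M _ HM] := cA.
exists M => M' MM' z z' z01 z01' zz'.
have b1 (y : nat -> R) : (forall i, 0 <= y i <= 1) -> forall i, `|y i| <= 1.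
  by move=> y01 i; have /andP[h1 h2] := y01 i; rewrite ger0_norm.
have cz := row_cvg _ _ _ cA (b1 _ z01); have cz' := row_cvg _ _ _ cA (b1 _ z01').
rewrite /row_sum -limB//.
set S := lim (series (fun i => `|A n i|) @ \oo) in HM.
apply: le_lt_trans (_ : e / 2 < e); last by rewrite ltr_pdivrMr// ltr_pMr// ltr1n.
suff H : \forall m \near \oo,
    `|series (fun i => A n i * z i) m - series (fun i => A n i * z' i) m| <= e / 2.
  rewrite -lim_norm; last exact: is_cvgB.
  apply: limr_le; last exact: H.
  by apply: is_cvg_norm; exact: is_cvgB.
exists M' => // m /= M'm.
have nd : {homo series (fun i => `|A n i|) : a b / (a <= b)%N >-> a <= b}.
  by apply/nondecreasing_seqP => i; rewrite -subr_ge0 seriesSB.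
have Sm : series (fun i => `|A n i|) m <= S by exact: nondecreasing_cvgn_le.
have h : `|S - series (fun i => `|A n i|) M'| < e / 2 := HM M' MM'.
rewrite /series/= -sumrB (@big_cat_nat _ _ _ M')//= big1_seq ?add0r; last first.
  move=> i /=; rewrite mem_index_iota => /andP[_ iM']. by rewrite /= zz' ?subrr.
apply: (@le_trans _ _ (\sum_(M' <= i < m) `|A n i|)).
  apply: (le_trans (ler_norm_sum _ _ _)); apply: ler_sum => i _.
  rewrite -mulrBr normrM ler_piMr//.
  have /andP[h1 h2] := z01 i; have /andP[h3 h4] := z01' i.
  by rewrite ler_norml; lra.
move: Sm h; rewrite /series/= (@big_cat_nat _ _ _ M' 0 m)//=.
rewrite ltr_norml; lra.
Qed.

(** * Cluster points and genericity *)

(** Finite sets lie in the ideal, so the indices of visits to a neighbourhood are unbounded. *)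
Lemma I_cluster_pointP {R : realType} {S : finType} (I : set (set nat))
    (u : nat -> vec R S) (eta : vec R S) :
  ideal_on_nat I -> I_cluster_point I u eta -> forall (e : R) N, 0 < e ->
  exists n, (N <= n)%N /\ forall s, `|u n s - eta s| < e.
Proof.
move=> [_ Isub Ifin _] cl e N e0; apply: contrapT => H.
pose B := [set y : vec R S | forall s, `|y s - eta s| < e].
have Beta : nbhs eta B by apply/nbhs_vec; exists e.
apply: (cl (interior B)) => //; first exact: open_interior.
apply: (Isub `I_N) (Ifin _ (finite_II N)) => n /= /interior_subset Bn.
by rewrite ltnNge; apply/negP => Nn; apply: H; exists n.
Qed.

Lemma I_cluster_point_linear {R : realType} {S : finType} (I : set (set nat))
    (u : nat -> vec R S) (eta : vec R S) (c : S -> R) (l : R) :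
  ideal_on_nat I -> I_cluster_point I u eta ->
  (\sum_s c s * u n s) @[n --> \oo] --> l -> \sum_s c s * eta s = l.
Proof.
move=> hI cl hl; apply/eqP; rewrite -subr_eq0 -normr_le0.
apply/ler_addgt0Pl => e e0; rewrite addr0.
pose C := \sum_s `|c s|; have C0 : 0 <= C by rewrite sumr_ge0.
have e2 : 0 < e / 2 by rewrite divr_gt0.
have eC : 0 < e / 2 / (C + 1) by rewrite divr_gt0// ltr_wpDl.
have /cvgrPdist_lt/(_ _ e2) [N _ HN] := hl.
have [n [Nn Hn]] := I_cluster_pointP I u eta hI cl _ N eC.
have h1 : `|l - \sum_s c s * u n s| < e / 2 := HN n Nn.
have h2 : `|\sum_s c s * u n s - \sum_s c s * eta s| <= e / 2.
  rewrite -sumrB; apply: (le_trans (ler_norm_sum _ _ _)).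
  apply: (@le_trans _ _ (\sum_s `|c s| * (e / 2 / (C + 1)))).
    by apply: ler_sum => s _; rewrite -mulrBr normrM ler_wpM2l// ltW.
  rewrite -mulr_suml -/C mulrA ler_pdivrMr ?ltr_wpDl// mulrC ler_pM2l//.
  by rewrite lerDl.
have -> : \sum_s c s * eta s - l = - (l - \sum_s c s * u n s) -
  (\sum_s c s * u n s - \sum_s c s * eta s) by ring.
by apply: (le_trans (ler_normB _ _)); rewrite normrN; lra.
Qed.

(** Once the rows are absolutely summable, the linear form commutes with the row sums, and
    regularity applies to the scalar sequence. *)
Lemma Aapp_linear_cvg {R : realType} {S : finType} (A : nat -> nat -> R)
    (z : nat -> vec R S) (c : S -> R) (l : R) :
  regular_matrix A ->
  (fun n => lim (series (fun i => `|A n i|) @ \oo)) @ \oo --> (1 : R) ->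
  (forall i s, `|z i s| <= 1) ->
  (\sum_s c s * z i s) @[i --> \oo] --> l ->
  (\sum_s c s * Aapp A z n s) @[n --> \oo] --> l.
Proof.
move=> rA A1 z1 zl; have [N HN] := rows_summable A A1.
apply: cvg_trans (regular_matrix_scalar A _ l rA zl).
apply: near_eq_cvg; exists N => // n Nn.
rewrite -row_sum_linear// => s; apply: row_cvg; [exact: HN|by move=> i].
Qed.

Lemma Gamma_sub_Delta {R : realType} (I : set (set nat)) (A : nat -> nat -> R)
    (b K : nat) (x : R) :
  ideal_on_nat I -> regular_matrix A ->
  (fun n => lim (series (fun i => `|A n i|) @ \oo)) @ \oo --> (1 : R) ->
  (2 <= b)%N -> 0 < x <= 1 -> Gamma b K.+1 x I A `<=` Delta b K.+1.
Proof.
move=> hI rA A1 b2 x01 eta; rewrite /Gamma/= pi_seqE => cl.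
have [_ db _ _] := digitP b x b2 x01.
have f01 i (s : str b K.+1) : 0 <= digit_freq (R := R) (digit b x) i s <= 1.
  by rewrite digit_freq_ge0 digit_freq_le1.
have f1 i (s : str b K.+1) : `|digit_freq (R := R) (digit b x) i s| <= 1.
  by have /andP[h1 h2] := f01 i s; rewrite ger0_norm.
have lin := Aapp_linear_cvg A _ _ _ rA A1 f1.
apply/DeltaE; split.
- rewrite -(I_cluster_point_linear I _ eta (fun=> 1) 1 hI cl).
    by apply: eq_bigr => s _; rewrite mul1r.
  apply: lin; rewrite (_ : (fun i => _) = fun=> 1); first exact: cvg_cst.
  apply/funext => i; rewrite -[RHS](@sum_digit_freq1 R b K.+1 _ i db).
  by apply: eq_bigr => s _; rewrite mul1r.
(* The rows' sums and their absolute sums both tend to 1, so the lower bound of [row_sum_ge] tends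
   to 0. *)
- move=> s; apply/ler_addgt0Pl => e e0.
  have e2 : 0 < e / 2 by rewrite divr_gt0.
  have [N HN] := rows_summable A A1.
  have c1 : row_sum A (fun=> 1) @ \oo --> (1 : R).
    by apply: (regular_matrix_scalar A _ 1 rA); exact: cvg_cst.
  have /cvgrPdist_lt/(_ _ e2) [N1 _ H1] := c1.
  have /cvgrPdist_lt/(_ _ e2) [N2 _ H2] := A1.
  have [n [Nn Hn]] := I_cluster_pointP I _ eta hI cl _ (N + N1 + N2)%N e2.
  have := row_sum_ge A (fun i => digit_freq (digit b x) i s) n
    (HN n _) (fun i => f01 i s).
  have /= := H1 n; have /= := H2 n; have := Hn s.
  rewrite !ltr_norml -[Aapp _ _ _ _]/(row_sum _ _ _) => h3 h4 h5.
  have /h4 : (N2 <= n)%N by lia.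
  have /h5 : (N1 <= n)%N by lia.
  by move=> h6 h7 /(_ ltac:(lia)); lra.
- move=> t; apply/eqP; rewrite -subr_eq0; apply/eqP.
  pose c (s : str b K.+1) : R := (str_tail s == t)%:R - (str_init s == t)%:R.
  have cE (y : str b K.+1 -> R) : \sum_s c s * y s =
      \sum_(s | str_tail s == t) y s - \sum_(s | str_init s == t) y s.
    rewrite [X in X - _]big_mkcond [X in _ - X]big_mkcond -sumrB.
    apply: eq_bigr => s _; rewrite /c mulrBl.
    by do 2!case: eqP => _; rewrite ?mul1r ?mul0r.
  rewrite -cE; apply: (I_cluster_point_linear I _ eta c 0 hI cl).
  apply: lin; rewrite (_ : (fun i => _) = fun i =>
    \sum_(s | str_tail s == t) digit_freq (digit b x) i s -
    \sum_(s | str_init s == t) digit_freq (digit b x) i s).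
    exact: digit_freq_flow.
  by apply/funext => i; rewrite cE.
Qed.

(** * Windows of rows near a given point, and Baire category *)

Lemma eq_digit_freq {R : realType} {b k : nat} (d d' : nat -> nat) (m : nat)
    (s : str b k) :
  (forall i, (0 < i <= m.+1 + k)%N -> d i = d' i) ->
  digit_freq (R := R) d m s = digit_freq d' m s.
Proof.
move=> dd'; rewrite /digit_freq; congr (_ / _); apply: eq_bigr => i _.
congr (_%:R); congr nat_of_bool; apply: eq_forallb => j; rewrite dd'//.
by have := ltn_ord i; have := ltn_ord j; lia.
Qed.

Lemma generic_interval {R : realType} (A : nat -> nat -> R) (m : nat -> nat)
    (b K : nat) (p : vec R (str b K.+1)) (U : set (vec R (str b K.+1)))
    (u v : R) (M : nat) :
  regular_matrix A ->
  (fun n => lim (series (fun i => `|A n i|) @ \oo)) @ \oo --> (1 : R) ->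
  (forall j, (m j < m j.+1)%N) -> (2 <= b)%N ->
  Delta b K.+1 p -> (forall s, 0 < p s) -> nbhs p U ->
  0 <= u -> u < v -> v <= 1 ->
  exists (j : nat) (u' v' : R), [/\ (M <= j)%N, u <= u', u' < v', v' <= v &
    forall x, u' < x < v' -> forall n, (m j <= n < m j.+1)%N ->
      U (Aapp A (pi_seq b K.+1 x) n)].
Proof.
move=> rA A1 mS b2 pD p0 /nbhs_vec[e e0 eU] u0 uv v1.
have e2 : 0 < e / 2 by rewrite divr_gt0.
have b0 : (0 < b)%N by exact: ltnW.
have [L [m0 [m0lt [um0 m0v]]]] := basic_interval b u v b2 u0 uv v1.
have [d0 [d0b d0v]] := digits_val_surj b L m0 m0lt.
have [d [db dd0 dfreq]] :=
  digit_freq_dense p d0 L pD p0 (fun i => d0b i b0).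
have dL : digits_val b d L = m0.
  by rewrite -d0v; apply: eq_digits_val => i /andP[_ iL]; exact: dd0.
have [N HN] := rows_summable A A1.
have /(_ _)/cvgrPdist_lt/(_ _ e2)/= rowcvg : forall s,
    row_sum A (fun i => digit_freq d i s) @ \oo --> p s.
  by move=> s; exact: regular_matrix_scalar rA (dfreq s).
have [N2 _ HN2] : \forall n \near \oo, forall s : str b K.+1,
    `|p s - row_sum A (fun i => digit_freq d i s) n| < e / 2.
  exact: filter_forall rowcvg.
(* Since [j <= m j], every row of window [j] is absolutely summable and sends the frequencies of [d]
   within [e / 2] of [p]. *)
pose j := (M + (N + N2))%N.
have [Mj Nj N2j] : [/\ (M <= j)%N, (N <= j)%N & (N2 <= j)%N].
  by split; [exact: leq_addr|rewrite /j addnCA leq_addr|rewrite /j addnA leq_addl].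
have mj : (j <= m j)%N.
  by elim: (j) => // i IH; exact: leq_ltn_trans IH (mS i).
have /choice [tl tlP] : forall n, exists T, (N <= n)%N -> forall M', (T <= M')%N ->
    forall z z' : nat -> R,
    (forall i, 0 <= z i <= 1) -> (forall i, 0 <= z' i <= 1) ->
    (forall i, (i < M')%N -> z i = z' i) ->
    `|row_sum A z n - row_sum A z' n| < e / 2.
  move=> n; have [Nn|] := leqP N n; last by exists 0%N.
  by have [T HT] := row_sum_tail A n _ (HN n Nn) e2; exists T.
(* [T] serves all the finitely many rows of the window at once. The first [T] frequency vectors read
   digits up to [T + K.+1], whence [k]. *)
pose T := \max_(n < m j.+1) tl n.
pose k := (T + K.+1)%N.
have bn0 : 0 < (b%:R ^+ (L + k))^-1 :> R by rewrite invr_gt0 exprn_gt0// ltr0n.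
have [h1] := @digits_val_addn R b d L k db; rewrite dL => h4.
exists j, ((digits_val b d (L + k))%:R / b%:R ^+ (L + k)),
  (((digits_val b d (L + k))%:R + 1) / b%:R ^+ (L + k)); split.
- exact: Mj.
- by apply: (le_trans um0); rewrite dL in h1.
- by rewrite ltr_pM2r// ltrDl.
- exact: le_trans h4 m0v.
move=> x xin n /andP[mn nm].
have x01 : 0 < x <= 1.
  move: xin => /andP[x1 x2]; apply/andP; split.
    by apply: le_lt_trans x1; rewrite divr_ge0.
  by apply: ltW; apply: lt_le_trans x2 _; apply: (le_trans h4); exact: le_trans m0v v1.
have xd := digit_cylinder b x d (L + k) b2 x01 db xin.
apply: eU => s; rewrite pi_seqE.
have [_ xb _ _] := digitP b x b2 x01.
have f01 dd i : 0 <= digit_freq (R := R) dd i s <= 1.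
  by rewrite digit_freq_ge0 digit_freq_le1.
have hT : (tl n <= T)%N by exact: (leq_bigmax (Ordinal nm)).
have jn : (j <= n)%N := leq_trans mj mn.
have Nn : (N <= n)%N := leq_trans Nj jn.
have agree i : (i < T)%N ->
    digit_freq (R := R) (digit b x) i s = digit_freq d i s.
  move=> iT; apply: eq_digit_freq => i' /andP[i'0 hi']; apply: xd.
  rewrite i'0 (leq_trans hi')// /k addnA leq_add2r.
  exact: leq_trans iT (leq_addl _ _).
have h5 := tlP n Nn T hT (fun i => digit_freq (digit b x) i s)
  (fun i => digit_freq d i s) (f01 _) (f01 _) agree.
have h6 : `|p s - row_sum A (fun i => digit_freq d i s) n| < e / 2.
  by apply: HN2; exact: leq_trans N2j jn.
move: h5 h6; rewrite !ltr_norml -[Aapp _ _ _ _]/(row_sum _ _ _); lra.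
Qed.

(** Reduces nowhere density in the subspace to ordinary real intervals. The interval taken lies to
    the left of the point, so that the endpoint 1 needs no separate case. *)
Lemma nowhere_dense_subspace {R : realType} (A : set R) :
  A `<=` [set x | 0 < x <= 1] ->
  (forall u v, 0 <= u -> u < v -> v <= 1 -> exists u' v',
    [/\ u <= u', u' < v', v' <= v & forall x, u' < x < v' -> ~ A x]) ->
  nowhere_dense_set (T := subspace [set x : R | 0 < x <= 1]) A.
Proof.
set D := [set x : R | 0 < x <= 1] => AD H.
apply/seteqP; split => // x; rewrite /interior/=.
have [Dx|Dx] := pselect (D x).
- rewrite /nbhs/= -nbhs_subspace_in// => /nbhs_ballP[e /= e0 he].
  have /andP[x0 x1] : 0 < x <= 1 by [].
  pose u := Num.max 0 (x - e).
  have ux : u < x by rewrite gt_max x0/= ltrBlDr ltrDl.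
  have u0 : 0 <= u by rewrite le_max lexx.
  have [u' [v' [uu' uv' vx' hA]]] := H u x u0 ux x1.
  pose y := (u' + v') / 2.
  have yin : u' < y < v' by rewrite /y; apply/andP; split; lra.
  have Dy : D y by rewrite /D/=; move: yin => /andP[? ?]; apply/andP; split; lra.
  have ue : x - e <= u by rewrite le_max lexx orbT.
  have cy : closure (A : set (subspace D)) y.
    apply: he => //; rewrite /ball/= ltr_norml; move: yin => /andP[? ?].
    by apply/andP; split; lra.
  have [|z [Az /= zin]] := cy `]u', v'[%classic; last first.
    by apply: (hA z) Az; move: zin; rewrite in_itv.
  rewrite /nbhs/= -nbhs_subspace_in//.
  have yV : nbhs (y : R) `]u', v'[%classic.
    by apply: open_nbhs_nbhs; split; [exact: interval_open|rewrite /= in_itv].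
  exact: cvg_within yV.
(* Points outside [D] are isolated in this topology, so the closure of a subset of [D] misses
   them. *)
- rewrite /nbhs/= -nbhs_subspace_out// => hx.
  have cx : closure (A : set (subspace D)) x by exact: hx.
  have [|z [Az /= zx]] := cx [set x]; last by apply: Dx; rewrite -zx; exact: AD.
  by rewrite /nbhs/= -nbhs_subspace_out.
Qed.

Lemma meager_countable_cover {T : topologicalType} {J : countType} (A : set T)
    (F : J -> set T) :
  (forall j, nowhere_dense_set (F j)) -> A `<=` \bigcup_j F j -> meager_set A.
Proof.
move=> ndF AF.
exists (fun n => if unpickle n is Some j then F j else set0); split.
  move=> n; case: unpickle => // ; rewrite /nowhere_dense_set.
  by rewrite closure0 interior0.
by move=> x /AF[j _ Fx]; exists (pickle j) => //; rewrite pickleK.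
Qed.

(** Move [p] slightly towards the uniform vector, a positive point of the convex set [Delta]. The
    bound [t <= 1 / 2] keeps coordinates positive, and [t <= e / 2] keeps the result near [p]. *)
Lemma Delta_gt0_dense {R : realType} (b K : nat) (p : vec R (str b K.+1))
    (U : set (vec R (str b K.+1))) :
  (0 < b)%N -> Delta b K.+1 p -> nbhs p U ->
  exists q, [/\ Delta b K.+1 q, forall s, 0 < q s & U q].
Proof.
move=> b0 /DeltaE[p1 p0 pflow] /nbhs_vec[e e0 eU].
have card0 : 0 < #|str b K.+1|%:R :> R.
  by rewrite ltr0n card_ffun !card_ord expn_gt0 b0.
have ple s : p s <= 1 by rewrite -p1 (bigD1 s)//= lerDl sumr_ge0.
have cle : (#|str b K.+1|%:R)^-1 <= 1 :> R.
  by rewrite invf_le1// ler1n -(ltr0n R).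
have cgt : 0 < (#|str b K.+1|%:R)^-1 :> R by rewrite invr_gt0.
pose c : R := (#|str b K.+1|%:R)^-1.
pose t := Num.min (1 / 2) (e / 2).
have t0 : 0 < t by rewrite lt_min !divr_gt0.
have t1 : t <= 1 / 2 by rewrite ge_min lexx.
have te : t <= e / 2 by rewrite ge_min lexx orbT.
have cflow (w : str b K) : \sum_(s : str b K.+1 | str_tail s == w) c =
    \sum_(s : str b K.+1 | str_init s == w) c.
  by rewrite -sum_str_cons -sum_str_snoc.
exists (fun s => p s + t * (c - p s)); split.
- apply/DeltaE; split.
  + rewrite big_split/= -mulr_sumr sumrB p1 sumr_const -[c *+ _]mulr_natl.
    by rewrite divff ?gt_eqF// subrr mulr0 addr0.
  + by move=> s; have := p0 s; have := ltW cgt; rewrite -/c; nra.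
  + by move=> w; rewrite !big_split/= -!mulr_sumr !sumrB pflow cflow.
- by move=> s; have := p0 s; have := cgt; rewrite -/c; nra.
- apply: eU => s; rewrite addrC addKr normrM (gtr0_norm t0).
  have : `|c - p s| <= 1.
    rewrite ler_norml; have := p0 s; have := ple s; have := ltW cgt.
    by move: cle; rewrite -/c; lra.
  by have := normr_ge0 (c - p s); nra.
Qed.

Theorem theorem4p7 (R : realType) (I : set (set nat)) (A : nat -> nat -> R) :
  ideal_on_nat I -> meager_ideal I ->
  regular_matrix A ->
  (fun n => lim (series (fun i => `|A n i|) @ \oo)) @ \oo --> (1 : R) ->
  let D := [set x : R | 0 < x <= 1] in
  meager_set (T := subspace D)
    (D `\` [set x | forall b k : nat, (2 <= b)%N -> (1 <= k)%N ->
                      Gamma b k x I A = Delta b k]).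
Proof.
move=> hI mI rA A1 D.
have [m [mS hm]] := talagrand I hI mI.
pose box b K (lo hi : {ffun str b K.+1 -> rat}) : set (vec R (str b K.+1)) :=
  [set y | forall s, ratr (lo s) < y s < ratr (hi s)].
have box_nbhs b K lo hi (p : vec R (str b K.+1)) :
    box b K lo hi p -> nbhs p (box b K lo hi).
  move=> hp.
  have /choice [r rP] : forall s, exists r : R, 0 < r /\
      forall y, `|y - p s| < r -> ratr (lo s) < y < ratr (hi s).
    move=> s; have /andP[h1 h2] := hp s.
    exists (Num.min (p s - ratr (lo s)) (ratr (hi s) - p s)); split.
      by rewrite lt_min !subr_gt0 h1.
    by move=> y; rewrite lt_min !ltr_norml => /andP[/andP[? ?] /andP[? ?]];
      apply/andP; split; lra.
  apply/nbhs_vec; exists (\big[Num.min/1]_s r s).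
    by elim/big_ind: _ => // [x y x0 y0|s _]; [rewrite lt_min x0|case: (rP s)].
  move=> y hy s; apply: (rP s).2; apply: (lt_le_trans (hy s)).
  exact: bigmin_le_cond.
(* An index consists of [b], [K] (standing for [k - 1]), the rational corners of a box, and a
   threshold beyond which a good window is demanded. *)
pose J : countType := {z : nat * nat &
  ({ffun str z.1 z.2.+1 -> rat} * {ffun str z.1 z.2.+1 -> rat} * nat)%type}.
pose good (j : J) (x : R) := exists i, (((projT2 j).2 <= i)%N /\
  forall n, (m i <= n < m i.+1)%N -> box _ _ (projT2 j).1.1 (projT2 j).1.2
    (Aapp A (pi_seq (projT1 j).1 (projT1 j).2.+1 x) n)).
pose bad (j : J) := [set x | [/\ D x, (2 <= (projT1 j).1)%N,
  exists p, [/\ Delta (projT1 j).1 (projT1 j).2.+1 p, forall s, 0 < p s &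
    box _ _ (projT2 j).1.1 (projT2 j).1.2 p] & ~ good j x]].
apply: (@meager_countable_cover (subspace D) J _ bad).
  move=> j; apply: nowhere_dense_subspace => [x []//|u v u0 uv v1].
  have [H|H] := pselect ((2 <= (projT1 j).1)%N /\
    exists p, [/\ Delta (projT1 j).1 (projT1 j).2.+1 p, forall s, 0 < p s &
    box _ _ (projT2 j).1.1 (projT2 j).1.2 p]); last first.
    (* Here [bad j] is empty, so the whole interval serves. *)
    by exists u, v; split => // x _ [_ b2 hp _]; exact: H.
  have [b2 [p [pD p0 /box_nbhs pU]]] := H.
  have [i [u' [v' [Mi uu' uv' vv' hi]]]] :=
    generic_interval A m _ _ p _ u v (projT2 j).2 rA A1 mS b2 pD p0 pU u0 uv v1.
  exists u', v'; split => // x xin [_ _ _]; apply; exists i; split => //.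
  exact: hi.
move=> x [Dx xbad]; apply: contrapT => Hx; apply: xbad => b [//|K] b2 _.
apply/seteqP; split; first exact: Gamma_sub_Delta.
move=> p pD U oU Up.
have /nbhs_vec[e e0 eU] : nbhs p U by exact: open_nbhs_nbhs.
have /choice [lo loP] : forall s, exists q : rat, p s - e < ratr q < p s.
  move=> s; have [|q] := @rat_in_itvoo R (p s - e) (p s); last first.
    by rewrite in_itv; exists q.
  by rewrite ltrBlDr ltrDl.
have /choice [hi hiP] : forall s, exists q : rat, p s < ratr q < p s + e.
  move=> s; have [|q] := @rat_in_itvoo R (p s) (p s + e); last first.
    by rewrite in_itv; exists q.
  by rewrite ltrDl.
pose L := [ffun s => lo s]; pose H := [ffun s => hi s].
have boxU : box b K L H `<=` U.
  move=> y hy; apply: eU => s; have := hy s; rewrite !ffunE => /andP[h1 h2].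
  have /andP[h3 h4] := loP s; have /andP[h5 h6] := hiP s.
  by rewrite ltr_norml; apply/andP; split; lra.
have pbox : box b K L H p.
  move=> s; rewrite !ffunE; have /andP[_ ->] := loP s.
  by have /andP[-> _] := hiP s.
have [q [qD q0 qbox]] :=
  Delta_gt0_dense b K p _ (ltnW b2) pD (box_nbhs _ _ _ _ _ pbox).
have [_ Isub _ _] := hI.
(* If visits to [U] formed a set in the ideal, so would visits to the smaller rational box. But that
   box contains a positive point [q] of [Delta], so [x], lying in no bad set, keeps it in view on
   whole windows arbitrarily far out. *)
move=> IU; apply: (hm [set n | box b K L H (Aapp A (pi_seq b K.+1 x) n)]).
  move=> M; apply: contrapT => nogood; apply: Hx.
  exists (existT _ (b, K) (L, H, M)) => //.
  by split => //=; exists q.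
by apply: Isub IU => n; exact: boxU.
Qed.
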